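(* Let $n\geq 10$ with $n\equiv 2\pmod 4$ and $r=5$. Let $V=\{v_1,\dots,v_n\}$ and consider the labelled path graph with edges: $\{v_1,v_2\}$ with label $0$; $\{v_2,v_3\}$ with label $1$; $\{v_3,v_4\}$ with the two labels $0$ and $2$; $\{v_4,v_5\}$ with label $1$; $\{v_5,v_6\}$ with label $2$; and for $6\leq s\leq n-1$, $\{v_s,v_{s+1}\}$ with label $3$ if $s$ is even and label $4$ if $s$ is odd. Then $G\cong A_n$ and $(G,(\rho_0,\dots,\rho_4))$ is a string C-group of rank 5 with Schläfli type $\{5,5,6,n-5\}$.
   Context: A string group generated by involutions (sggi) of rank $r$ is a pair $(G,(\rho_0,\dots,\rho_{r-1}))$ where $\rho_0,\dots,\rho_{r-1}$ are involutions generating the group $G$ such that $(\rho_i\rho_j)^2=1$ whenever $|i-j|\geq 2$. It is a string C-group if in addition it satisfies the intersection property: for all $J,K\subseteq\{0,\dots,r-1\}$, $\langle \rho_j : j\in J\rangle\cap\langle\rho_k : k\in K\rangle=\langle \rho_j : j\in J\cap K\rangle$. The Schläfli type is $\{p_1,\dots,p_{r-1}\}$ where $p_i$ is the order of $\rho_{i-1}\rho_i$. Labelled-graph convention: the vertex set $V$ is finite, and each edge $\{a,b\}$ ($a\neq b$) carries one or more labels from $\{0,\dots,r-1\}$, the edges carrying any given label being pairwise disjoint; $\rho_k$ denotes the permutation of $V$ equal to the product of the transpositions $(a\,b)$ over all edges $\{a,b\}$ carrying label $k$, and $G=\langle\rho_0,\dots,\rho_{r-1}\rangle\leq \mathrm{Sym}(V)$.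 *)

(* Defs.v *)
From HB Require Import structures.
From mathcomp Require Import all_boot all_fingroup all_solvable.
Set Implicit Arguments. Unset Strict Implicit. Unset Printing Implicit Defensive.
Import GroupScope.

(* Labelled graph on vertex set 'I_n (vertex v_i of the paper is the ordinal i-1).
   An edge is (a, b, labels) with a, b naturals (< n).  rho_k is the product of
   the transpositions (a b) over all edges carrying label k. *)
Definition edge_tperm (n : nat) (e : nat * nat * seq nat) : {perm 'I_n} :=
  match insub e.1.1, insub e.1.2 with
  | Some a, Some b => tperm a b
  | _, _ => 1
  end.

Definition lgraph_perm (n : nat) (E : seq (nat * nat * seq nat)) (k : nat)
  : {perm 'I_n} :=
  \prod_(e <- E | k \in e.2) edge_tperm n e.

Definition gens (gT : finGroupType) (r : nat) (rho : nat -> gT) (J : {set 'I_r})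
  : {set gT} := <<[set rho (nat_of_ord j) | j in J]>>.

Definition sggi_group (gT : finGroupType) (r : nat) (rho : nat -> gT) : {set gT} :=
  gens rho [set: 'I_r].

Definition is_sggi (gT : finGroupType) (r : nat) (rho : nat -> gT) : Prop :=
  (forall i, (i < r)%N -> #[rho i] = 2) /\
  (forall i j, (i < r)%N -> (j < r)%N -> (i + 2 <= j)%N -> (rho i * rho j) ^+ 2 = 1).

Definition intersection_property (gT : finGroupType) (r : nat) (rho : nat -> gT)
  : Prop :=
  forall J K : {set 'I_r}, gens rho J :&: gens rho K = gens rho (J :&: K).

Definition is_string_C_group (gT : finGroupType) (r : nat) (rho : nat -> gT)
  : Prop := is_sggi r rho /\ intersection_property r rho.

Definition schlafli_type (gT : finGroupType) (r : nat) (rho : nat -> gT) : seq nat :=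
  [seq #[rho i.-1 * rho i] | i <- iota 1 r.-1].

Close Scope group_scope.

Definition thm43_edges (n : nat) : seq (nat * nat * seq nat) :=
  [:: (0, 1, [:: 0]); (1, 2, [:: 1]); (2, 3, [:: 0; 2]); (3, 4, [:: 1]);
      (4, 5, [:: 2])] ++
  [seq (s.-1, s, [:: if odd s then 4 else 3]) | s <- iota 6 (n - 6)].

(* Main.v *)
(* Number the points from 0 to N = n - 1, and let G_J be the group generated by the
   rho_j with j in J.  The intersection property holds as soon as every G_J is the
   intersection of the maximal G_K containing it, hence as soon as every J with at
   least two missing labels has a missing label i such that every element of G_(J + i)
   lying in the maximal group without rho_i lies in G_J.  Such a label is found from
   what the maximal groups fix or stabilise: the ends 0 and N of the path, the initial
   segment of six points, the blocks {0, 1}, {2, 3} and {4, ..., N}.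

   Three facts on small groups are needed.  In a dihedral group acting on a path, the
   stabiliser of an end is generated by one reflection.  The group <rho_0, rho_1, rho_2>
   preserves a two-graph on six points, which bounds its stabiliser of 0 by the group of
   a pentagon.  Finally rho_3 = (5 6) tau, where tau is supported beyond 6, so that
   <rho_0, ..., rho_3> consists of elements s tau^(sign s) with s moving 0, ..., 6 only;
   for such s, s tau^(sign s) lies in a group H as soon as (x (s x)) tau does for every
   moved x.  The last criterion, for any twist in place of tau, also shows that the whole
   group contains the alternating group. *)
Require Import Defs.
From HB Require Import structures.
From mathcomp Require Import all_boot all_fingroup all_solvable.
From mathcomp Require Import zify.
Set Implicit Arguments. Unset Strict Implicit. Unset Printing Implicit Defensive.
Local Open Scope group_scope.

(** * Generated groups and products of two involutions *)

(** In a finite group inverses are positive powers, so right multiplication by generators reaches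
    every element. *)
Lemma gen_ind (gT : finGroupType) (A : {set gT}) (P : gT -> Prop) :
    P 1 -> (forall g a, P g -> a \in A -> P (g * a)) ->
  forall g, g \in <<A>> -> P g.
Proof.
move=> P1 PM g /gen_prodgP[n [c cA ->]].
elim: n c cA => [|n IHn] c cA; first by rewrite big_ord0.
by rewrite big_ord_recr; apply: PM => //; apply: IHn => i; apply: cA.
Qed.

(** Conjugation by [s] inverts [s * t], so [<[s]>] normalises [<[s * t]>] and the product of the two
    is a group; it contains [s] and [t = s * (s * t)]. *)
Lemma dihedral_mul (gT : finGroupType) (s t : gT) :
  s * s = 1 -> t * t = 1 -> <<[set s; t]>> \subset <[s * t]> * <[s]>.
Proof.
move=> ss tt; have Vs : s^-1 = s by apply/eqP; rewrite eq_invg_mul ss.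
have Vt : t^-1 = t by apply/eqP; rewrite eq_invg_mul tt.
have nrm : <[s]> \subset 'N(<[s * t]>).
  rewrite cycle_subG inE -cycleJ cycle_subG.
  rewrite conjgE Vs 2!mulgA ss mul1g (_ : t * s = (s * t)^-1) ?invMg ?Vs ?Vt //.
  by rewrite -{1}Vt -{1}Vs -invMg groupV cycle_id.
rewrite -norm_joinEr // gen_subG subUset !sub1set.
have sJ : s \in <[s * t]> <*> <[s]> by rewrite (subsetP (joing_subr _ _)) ?cycle_id.
have: s * (s * t) \in <[s * t]> <*> <[s]>.
  by rewrite groupM // (subsetP (joing_subl _ _)) ?cycle_id.
by rewrite mulgA ss mul1g => ->; rewrite sJ.
Qed.

(** * Twisted transpositions and a membership criterion *)

Section Twist.
Variables (T : finType) (H : {group {perm T}}) (z : {perm T}).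

(** Equality is included because [tperm x x * z] is [z], which need not lie in [H]; with it the
    relation is an equivalence. *)
Definition twist_linked x y := (x == y) || (tperm x y * z \in H).

Lemma twist_linked_sym x y : twist_linked x y = twist_linked y x.
Proof. by rewrite /twist_linked eq_sym tpermC. Qed.

(* (y w)z ((x y)z)^-1 (y w)z = (x w)z, whatever z is. *)
Lemma twist_linked_trans x y w :
  twist_linked x y -> twist_linked y w -> twist_linked x w.
Proof.
rewrite /twist_linked; have [-> //|nxy] := eqVneq x y.
have [<-|nyw] := eqVneq y w; first by move=> /= ->; rewrite orbT.
have [//|nxw] := eqVneq x w => /= Hxy Hyw.
have -> : tperm x w = tperm y w * tperm x y * tperm y w.
  rewrite -{1}(tpermV y w) -mulgA -conjgE tpermJ tpermD 1?eq_sym // tpermL.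
  by [].
have -> : tperm y w * tperm x y * tperm y w * z =
    (tperm y w * z) * (tperm x y * z)^-1 * (tperm y w * z).
  by rewrite invMg tpermV !mulgA mulgK.
by rewrite groupM // groupM // groupV.
Qed.

(** Conjugation by [h] stays in [H], fixes [z] and renames the two points of the transposition. This
    carries known links to new points. *)
Lemma twist_linkedJ h x y : h \in H -> commute h z ->
  twist_linked x y -> twist_linked (h x) (h y).
Proof.
move=> Hh hz; rewrite /twist_linked (inj_eq perm_inj) => /orP[->//|Hxy].
have zh : z ^ h = z by rewrite conjgE -hz mulKg.
by rewrite -tpermJ -[X in _ * X]zh -conjMg groupJ ?orbT.
Qed.

(** Induction on the number of moved points. Multiplying [s] by [tperm x (s x)] fixes [x], moves no
    new point and changes the sign; the factor [tperm x (s x) * z] or its inverse then restores [s]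
    with the right power of [z]. *)
Lemma twisted_perm_mem (s : {perm T}) :
  (forall x, twist_linked x (s x)) -> s * z ^+ odd_perm s \in H.
Proof.
elim: {s}_.+1 {-2}s (ltnSn #|[pred x | s x != x]|) => // m IHm s.
rewrite ltnS => les lnk.
have [x sx|s1] := pickP [pred x | s x != x]; last first.
  have -> : s = 1 by apply/permP=> x; rewrite perm1; apply/eqP/negbFE/s1.
  by rewrite odd_perm1 mulg1 group1.
move: (sx) => /= nsx.
pose t := tperm x (s x); have tV : t * t = 1 by rewrite tperm2.
have Es y : (s * t) y = if y == x then x else if s y == x then s x else s y.
  rewrite permM; have [->|nyx] := eqVneq y x; first by rewrite tpermR.
  have [->|nsyx] := eqVneq; first by rewrite tpermL.
  by rewrite tpermD // 1?eq_sym // (inj_eq perm_inj).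
have {}IHm: (s * t) * z ^+ odd_perm (s * t) \in H.
  apply: IHm => [|y].
    apply: leq_trans les; apply: proper_card; apply/properP; split.
      apply/subsetP=> y; rewrite !inE Es; have [->|nyx] := eqVneq y x; rewrite ?eqxx //.
      by have [-> _|//] := eqVneq (s y) x; rewrite eq_sym.
    by exists x => //; rewrite inE Es !eqxx.
  rewrite Es; have [->|_] := eqVneq y x; first by rewrite /twist_linked eqxx.
  by case: eqVneq => [sy|_ //]; apply: twist_linked_trans (lnk x); rewrite -sy.
have tz : t * z \in H by have := lnk x; rewrite /twist_linked eq_sym (negPf nsx).
rewrite odd_permM odd_tperm eq_sym nsx addbT in IHm.
case: (odd_perm s) IHm => /= IHm.
  rewrite expg0 mulg1 in IHm.
  have -> : s * z ^+ true = s * t * (t * z) by rewrite mulgA -(mulgA s) tV mulg1.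
  by rewrite groupM.
rewrite mulg1; rewrite expg1 in IHm.
have -> : s = s * t * z * (t * z)^-1 by rewrite invMg tpermV mulgA mulgK -mulgA tV mulg1.
by rewrite groupM // groupV.
Qed.
End Twist.

(** * Dihedral groups acting on a path *)

Section Dih.
Variables (T : finType) (s t : {perm T}) (e : T).
Hypotheses (ss : s * s = 1) (tt : t * t = 1) (se : s e = e).

(** As [s] fixes [e] and inverts the rotation [s * t], it swaps the images of [e] under opposite
    powers of the rotation; [t] is [s] followed by the rotation. *)
Lemma dihedral_porbit_closed x : x \in porbit (s * t) e ->
  s x \in porbit (s * t) e /\ t x \in porbit (s * t) e.
Proof.
have Vs : s^-1 = s by apply/eqP; rewrite eq_invg_mul ss.
have Vt : t^-1 = t by apply/eqP; rewrite eq_invg_mul tt.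
have Hs y : y \in porbit (s * t) e -> s y \in porbit (s * t) e.
  case/porbitP => k ->; rewrite -porbitV invMg Vs Vt.
  have -> : s (((s * t) ^+ k) e) = ((t * s) ^+ k) e; last exact: mem_porbit.
  have <- : ((s * t) ^+ k) ^ s = (t * s) ^+ k.
    by rewrite conjXg conjgE Vs !mulgA ss mul1g.
  by rewrite conjgE Vs !permM se.
move=> xP; split; first exact: Hs.
have -> : t x = (s * t) (s x) by rewrite -permM mulgA ss mul1g.
by rewrite -eq_porbit_mem (porbit_perm _ 1) eq_porbit_mem; apply: Hs.
Qed.

Hypothesis orb : forall x, s x != x \/ t x != x -> x \in porbit (s * t) e.

(** Powers of the rotation commute, so one that fixes a point fixes its whole orbit; by [orb]
    nothing outside this orbit moves. *)
Lemma dihedral_rot_free k e' : e' \in porbit (s * t) e ->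
  ((s * t) ^+ k) e' = e' -> (s * t) ^+ k = 1.
Proof.
move=> e'P fixe; apply/permP=> x; rewrite perm1.
have [xP|/negP xP] := boolP (x \in porbit (s * t) e'); last first.
  move: e'P xP; rewrite -eq_porbit_mem => /eqP-> xP.
  have sx : s x = x by apply/eqP/contraT => sx; case: xP; apply: orb; left.
  have tx : t x = x by apply/eqP/contraT => tx; case: xP; apply: orb; right.
  have fx : (s * t) x = x by rewrite permM sx.
  by rewrite permX; elim: k {fixe} => //= k ->.
case/porbitP: xP => i ->; rewrite -!permM -!expgD addnC expgD permM fixe //.
Qed.

(** The power of the rotation by the length of the orbit fixes [e], hence is trivial; conversely an
    orbit is never longer than the order. *)
Lemma dihedral_order : #[s * t] = #|porbit (s * t) e|.
Proof.
apply/eqP; rewrite eqn_leq; apply/andP; split.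
  apply: dvdn_leq; first by rewrite lt0n card_porbit_neq0.
  rewrite order_dvdn; apply/eqP/(dihedral_rot_free (porbit_id _ _)).
  by rewrite permX iter_porbit.
by rewrite porbit.unlock leq_imset_card.
Qed.

(** Write [a] as a rotation followed by a power of [s]. Both [a] and [s] fix [e'], so the rotation
    does too and is trivial. *)
Lemma dihedral_stab e' a : e' \in porbit (s * t) e -> a \in <<[set s; t]>> ->
  a e' = e' -> s e' = e' -> a \in <[s]>.
Proof.
move=> e'P /(subsetP (dihedral_mul ss tt)) /mulsgP[_ w /cycleP[k ->] ws ->].
rewrite permM => aE sE.
suff -> : (s * t) ^+ k = 1 by rewrite mul1g.
apply: dihedral_rot_free (e'P) _.
case/cycleP: ws aE => i -> aE.
have fixi : forall i, (s ^+ i) e' = e' by move=> j; rewrite permX; elim: j => //= j ->.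
by apply: (@perm_inj _ (s ^+ i)); rewrite aE fixi.
Qed.
End Dih.

(** The rotations [s * t] and [t * s] are mutually inverse and have the same orbits, so the two
    reflections can be exchanged. *)
Lemma dihedral_stabr (T : finType) (s t : {perm T}) e e' a :
    s * s = 1 -> t * t = 1 ->
    (forall x, s x != x \/ t x != x -> x \in porbit (s * t) e) ->
  e' \in porbit (s * t) e -> a \in <<[set s; t]>> -> a e' = e' -> t e' = e' ->
  a \in <[t]>.
Proof.
move=> ss tt; have -> : s * t = (t * s)^-1.
  apply/esym/eqP; rewrite eq_invg_mul mulgA -(mulgA t) ss mulg1.
  by rewrite tt.
rewrite porbitV setUC => orb; apply: dihedral_stab => // x hx.
by apply: orb; case: hx; [right | left].
Qed.

(** * Subgroups generated by some of the generators, and the intersection property *)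

Section Gens.
Variables (gT : finGroupType) (r : nat) (rho : nat -> gT).
Implicit Types J K : {set 'I_r}.

Canonical gens_group J := Eval hnf in [group of gens rho J].

Lemma mem_gens J (i : 'I_r) : i \in J -> rho i \in gens rho J.
Proof. by move=> iJ; apply/mem_gen/imset_f. Qed.

Lemma gens_subset J (H : {group gT}) :
  (forall i : 'I_r, i \in J -> rho i \in H) -> gens rho J \subset H.
Proof. by move=> JH; rewrite gen_subG; apply/subsetP=> _ /imsetP[i iJ ->]; apply: JH. Qed.

Lemma gensS J K : J \subset K -> gens rho J \subset gens rho K.
Proof. by move=> sJK; apply/genS/imsetS. Qed.

Lemma gens_mul J K :
    (forall i j : 'I_r, i \in J -> j \in K -> commute (rho i) (rho j)) ->
  gens rho (J :|: K) = gens rho J * gens rho K.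
Proof.
move=> cJK; rewrite -cent_joinEr /= /gens.
  by rewrite imsetU joing_idl joing_idr.
rewrite /= /gens cent_gen gen_subG; apply/subsetP=> _ /imsetP[j jK ->].
by apply/centP=> _ /imsetP[i iJ ->]; apply/commute_sym/cJK.
Qed.

(** A label outside [J :&: K] is outside [J] or outside [K], and the maximal group without it then
    contains [gens rho J] or [gens rho K]. *)
Lemma intersection_property_maximal :
    (forall J g, g \in sggi_group r rho ->
      (forall i, i \notin J -> g \in gens rho (~: [set i])) -> g \in gens rho J) ->
  intersection_property r rho.
Proof.
move=> maxP J K; apply/setP=> g; apply/setIP/idP=> [[gJ gK]|gJK]; last first.
  by split; apply: subsetP gJK; rewrite gensS ?subsetIl ?subsetIr.
apply: maxP => [|i]; first exact: subsetP (gensS (subsetT J)) _ gJ.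
rewrite inE negb_and => /orP[iJ|iK].
  by apply: subsetP gJ; rewrite gensS // subsetC sub1set inE.
by apply: subsetP gK; rewrite gensS // subsetC sub1set inE.
Qed.
End Gens.

Section PermGens.
Variables (T : finType) (r : nat) (rho : nat -> {perm T}) (J : {set 'I_r}).

Lemma gens_stable (P : pred T) :
    (forall (i : 'I_r) x, i \in J -> P x -> P (rho i x)) ->
  forall g x, g \in gens rho J -> P x -> P (g x).
Proof.
move=> PJ g x; move: g; apply: (@gen_ind _ _ (fun g : {perm T} => P x -> P (g x))).
  by rewrite perm1.
by move=> g _ IH /imsetP[i iJ ->] Px; rewrite permM; apply: PJ => //; apply: IH.
Qed.

Lemma gens_fix x : (forall i : 'I_r, i \in J -> rho i x = x) ->
  forall g, g \in gens rho J -> g x = x.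
Proof.
move=> fixJ g gJ; apply/eqP; apply: (gens_stable (P := pred1 x)) gJ _ => //= i y iJ /eqP->.
by rewrite fixJ.
Qed.
End PermGens.

(** * Rank five, with sets of labels coded by five Booleans so that case analysis runs on flags *)

Definition par (gT : finGroupType) (rho : nat -> gT) b0 b1 b2 b3 b4 :=
  gens rho [set i : 'I_5 | nth false [:: b0; b1; b2; b3; b4] i].
Canonical par_group (gT : finGroupType) (rho : nat -> gT) b0 b1 b2 b3 b4 :=
  Eval hnf in [group of par rho b0 b1 b2 b3 b4].

Lemma forall_ord5 (P : 'I_5 -> Prop) :
  P (inord 0) -> P (inord 1) -> P (inord 2) -> P (inord 3) -> P (inord 4) ->
  forall i, P i.
Proof.
move=> P0 P1 P2 P3 P4 i; rewrite -[i]inord_val.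
by case: i => -[|[|[|[|[|k]]]]] h.
Qed.

Lemma par_gens (gT : finGroupType) (rho : nat -> gT) (J : {set 'I_5}) :
  gens rho J = par rho (inord 0 \in J) (inord 1 \in J) (inord 2 \in J) (inord 3 \in J)
    (inord 4 \in J).
Proof.
by congr gens; apply/setP; apply: forall_ord5; rewrite inE inordK.
Qed.

(* The product of the transpositions (s - 1, s) with 6 <= s < 6 + m and odd s = p. *)
Definition tail_fun (p : bool) m x :=
  if (odd x == p) && (6 <= x < 6 + m) then x.-1
  else if (odd x != p) && (6 <= x.+1 < 6 + m) then x.+1 else x.

(** On natural numbers the first points are settled by computation and the tail by linear
    arithmetic. The tail has [N - 5] edges because there are [N + 1] vertices. *)
Definition rho_fun N k x : nat :=
  match k, x with
  | 0, 0 => 1 | 0, 1 => 0 | 0, 2 => 3 | 0, 3 => 2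
  | 1, 1 => 2 | 1, 2 => 1 | 1, 3 => 4 | 1, 4 => 3
  | 2, 2 => 3 | 2, 3 => 2 | 2, 4 => 5 | 2, 5 => 4
  | 3, _ => tail_fun false (N - 5) x
  | 4, _ => tail_fun true (N - 5) x
  | _, _ => x
  end.

Section Par.
Variables (gT : finGroupType) (rho : nat -> gT).

Lemma par_subset (b0 b1 b2 b3 b4 : bool) (H : {group gT}) :
    (b0 -> rho 0 \in H) -> (b1 -> rho 1%N \in H) -> (b2 -> rho 2 \in H) ->
    (b3 -> rho 3 \in H) -> (b4 -> rho 4 \in H) ->
  par rho b0 b1 b2 b3 b4 \subset H.
Proof.
by move=> *; apply: gens_subset; apply: forall_ord5; rewrite inE !inordK.
Qed.

Lemma mem_par k (b0 b1 b2 b3 b4 : bool) : (k < 5)%N ->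
  nth false [:: b0; b1; b2; b3; b4] k -> rho k \in par rho b0 b1 b2 b3 b4.
Proof.
by move=> k5 bk; rewrite -(inordK k5); apply: mem_gens; rewrite inE inordK.
Qed.

Lemma parS (b0 b1 b2 b3 b4 c0 c1 c2 c3 c4 : bool) :
    (b0 -> c0) -> (b1 -> c1) -> (b2 -> c2) -> (b3 -> c3) -> (b4 -> c4) ->
  par rho b0 b1 b2 b3 b4 \subset par rho c0 c1 c2 c3 c4.
Proof.
by move=> *; apply: gensS; apply/subsetP; apply: forall_ord5; rewrite !inE inordK.
Qed.

Hypothesis comm : forall i j, (i.+1 < j < 5)%N -> commute (rho i) (rho j).

(** Without an inner label the string breaks into two pieces whose generators commute with each
    other; the same holds for the next two lemmas. *)
Lemma par_split1 b0 b2 b3 b4 : par rho b0 false b2 b3 b4 =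
  par rho b0 false false false false * par rho false false b2 b3 b4.
Proof.
rewrite -gens_mul.
  by congr gens; apply/setP; apply: forall_ord5; rewrite !inE inordK //= ?orbF.
apply: forall_ord5 => j; rewrite inE inordK //= => _; rewrite inE.
by case: j => -[|[|[|[|[|j]]]]] // h _; apply: comm.
Qed.

Lemma par_split2 b0 b1 b3 b4 : par rho b0 b1 false b3 b4 =
  par rho b0 b1 false false false * par rho false false false b3 b4.
Proof.
rewrite -gens_mul.
  by congr gens; apply/setP; apply: forall_ord5; rewrite !inE inordK //= ?orbF.
apply: forall_ord5 => j; rewrite inE inordK //= => _; rewrite inE;
  by case: j => -[|[|[|[|[|j]]]]] // h _; apply: comm.
Qed.

Lemma par_split3 b0 b1 b2 b4 : par rho b0 b1 b2 false b4 =
  par rho b0 b1 b2 false false * par rho false false false false b4.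
Proof.
rewrite -gens_mul.
  by congr gens; apply/setP; apply: forall_ord5; rewrite !inE inordK //= ?orbF.
apply: forall_ord5 => j; rewrite inE inordK //= => _; rewrite inE;
  by case: j => -[|[|[|[|[|j]]]]] // h _; apply: comm.
Qed.
End Par.

Lemma cycle_involution (gT : finGroupType) (s g : gT) : s * s = 1 -> g \in <[s]> -> g = 1 \/ g = s.
Proof.
move=> ss /cycleP[k ->]; rewrite -(odd_double_half k) expgD -mul2n expgM [s ^+ 2]ss.
by rewrite expg1n mulg1; case: odd; [right | left].
Qed.

Lemma commute_tperm (T : finType) (h : {perm T}) a b :
  h a = a -> h b = b -> commute h (tperm a b).
Proof. by move=> ha hb; apply/commute_sym/commgP/conjg_fixP; rewrite tpermJ ha hb. Qed.

(** The orbits of the generators other than [rho 1]. *)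
Definition block z := if (z < 2)%N then 0 else if (z < 4)%N then 1%N else 2.

(** * The generators of the labelled path, computed on the points 0 to N *)

Section Main.
Variable N : nat.
Hypotheses (N_ge9 : (9 <= N)%N) (N_mod4 : N %% 4 = 1%N).
Local Notation rho := (lgraph_perm N.+1 (thm43_edges N.+1)).
Local Notation f := (rho_fun N).
Local Notation pt k := (@inord N k).

Lemma edge_tpermE a b l : (a <= N)%N -> (b <= N)%N ->
  edge_tperm N.+1 (a, b, l) = tperm (pt a) (pt b).
Proof.
move=> aN bN; rewrite /edge_tperm /=.
suff E k : (k <= N)%N -> insub k = Some (pt k) by rewrite !E.
by move=> kN; rewrite insubT; congr Some; apply: val_inj; rewrite /= inordK.
Qed.

Lemma tperm_val a b (x : 'I_N.+1) : (a <= N)%N -> (b <= N)%N ->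
  tperm (pt a) (pt b) x = (if x == a :> nat then b else if x == b :> nat then a else x) :> nat.
Proof.
move=> aN bN; case: tpermP => [->|->|]; rewrite ?inordK ?eqxx //.
  by case: eqP => // ->.
move=> /eqP xa /eqP xb; rewrite -!val_eqE /= !inordK // in xa xb.
by rewrite (negPf xa) (negPf xb).
Qed.

Definition tail p m : {perm 'I_N.+1} :=
  \prod_(s <- iota 6 m | odd s == p) tperm (pt s.-1) (pt s).

Lemma tailS p m : tail p m.+1 =
   tail p m * (if odd (6 + m) == p then tperm (pt (6 + m).-1) (pt (6 + m)) else 1).
Proof. by rewrite /tail -[m.+1]addn1 iotaD big_cat /= big_cons big_nil mulg1. Qed.

Lemma tail_val p m (x : 'I_N.+1) : (6 + m <= N.+1)%N -> tail p m x = tail_fun p m x :> nat.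
Proof.
elim: m x => [|m IHm] x hm.
  by rewrite /tail big_nil perm1 /tail_fun; do !case: ifP => //; lia.
have {}IHm := IHm x (ltnW hm); rewrite tailS permM.
case: ifP => op; last first.
  rewrite perm1 IHm /tail_fun; do !case: ifP => //; lia.
rewrite tperm_val; [|lia|lia]; rewrite IHm /tail_fun.
do !case: ifP => //; lia.
Qed.

(** Four consecutive values of [s] contain two of each parity, so every group of four contributes
    two transpositions. The congruence on [N] makes [N - 5] a multiple of four. *)
Lemma tail_even p m : (6 + 4 * m <= N.+1)%N -> odd_perm (tail p (4 * m)) = false.
Proof.
elim: m => [|m IHm] hm; first by rewrite /tail big_nil odd_perm1.
rewrite mulnSr addn4 !tailS !odd_permM IHm; last lia.
have tailJ s : (6 <= s <= N)%N ->
    odd_perm (if odd s == p then tperm (pt s.-1) (pt s) else 1) = (odd s == p).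
  move=> hs; case: ifP => _; last by rewrite odd_perm1.
  by rewrite odd_tperm -val_eqE /= !inordK; lia.
by rewrite !tailJ; try lia; rewrite !oddD /= !oddM /=; case: p.
Qed.

Lemma rho_tail k : rho k =
  \prod_(e <- [:: (0, 1, [:: 0]); (1, 2, [:: 1]); (2, 3, [:: 0; 2]); (3, 4, [:: 1]);
      (4, 5, [:: 2])]%N | k \in e.2) edge_tperm N.+1 e *
  (if k == 3%N then tail false (N - 5) else if k == 4%N then tail true (N - 5) else 1).
Proof.
rewrite /lgraph_perm /thm43_edges big_cat; congr (_ * _).
rewrite big_map (_ : N.+1 - 6 = N - 5)%N; last lia.
rewrite big_seq_cond (eq_bigr (fun s => tperm (pt s.-1) (pt s))); last first.
  move=> s; rewrite mem_iota => /andP[hs _]; rewrite edge_tpermE //; lia.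
have [->|k3] := eqVneq k 3%N; last have [->|k4] := eqVneq k 4%N.
- by rewrite -big_seq_cond; apply: eq_bigl => s; rewrite /= inE; case: odd.
- by rewrite -big_seq_cond; apply: eq_bigl => s; rewrite /= inE; case: odd.
apply: big_pred0 => s; apply/negP => /andP[_ /=]; rewrite inE; case: odd => /eqP; lia.
Qed.

Lemma rho0E : rho 0 = tperm (pt 0) (pt 1) * tperm (pt 2) (pt 3).
Proof. by rewrite rho_tail !big_cons big_nil /= !edge_tpermE ?mulg1 //; lia. Qed.
Lemma rho1E : rho 1 = tperm (pt 1) (pt 2) * tperm (pt 3) (pt 4).
Proof. by rewrite rho_tail !big_cons big_nil /= !edge_tpermE ?mulg1 //; lia. Qed.
Lemma rho2E : rho 2 = tperm (pt 2) (pt 3) * tperm (pt 4) (pt 5).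
Proof. by rewrite rho_tail !big_cons big_nil /= !edge_tpermE ?mulg1 //; lia. Qed.
Lemma rho3E : rho 3 = tail false (N - 5).
Proof. by rewrite rho_tail !big_cons big_nil /= mul1g. Qed.
Lemma rho4E : rho 4 = tail true (N - 5).
Proof. by rewrite rho_tail !big_cons big_nil /= mul1g. Qed.

Lemma rho_val k (x : 'I_N.+1) : (k < 5)%N -> rho k x = f k x :> nat.
Proof.
have small_val a b c d :  (a < b)%N -> (b < c)%N -> (c < d)%N -> (d <= N)%N ->
   (tperm (pt a) (pt b) * tperm (pt c) (pt d)) x =
   (if x == a :> nat then b else if x == b :> nat then a else
    if x == c :> nat then d else if x == d :> nat then c else x) :> nat.
  move=> *; rewrite permM !tperm_val; try lia.
  do !case: ifP => //; lia.
case: k => [|[|[|[|[|//]]]]] _.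
- by rewrite rho0E small_val //; try lia; case: (val x) => [|[|[|[|y]]]].
- by rewrite rho1E small_val //; try lia; case: (val x) => [|[|[|[|[|y]]]]].
- by rewrite rho2E small_val //; try lia; case: (val x) => [|[|[|[|[|[|y]]]]]].
- by rewrite rho3E tail_val //; lia.
- by rewrite rho4E tail_val //; lia.
Qed.

Lemma rho_even k : (k < 5)%N -> odd_perm (rho k) = false.
Proof.
have neq a b : (a < b)%N -> (b <= N)%N -> pt a != pt b.
  by move=> ab bN; rewrite -val_eqE /= !inordK; lia.
have N4 : (N - 5 = 4 * ((N - 5) %/ 4))%N by lia.
case: k => [|[|[|[|[|//]]]]] _.
- by rewrite rho0E odd_permM !odd_tperm !neq //; lia.
- by rewrite rho1E odd_permM !odd_tperm !neq //; lia.
- by rewrite rho2E odd_permM !odd_tperm !neq //; lia.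
- by rewrite rho3E N4 tail_even //; lia.
- by rewrite rho4E N4 tail_even //; lia.
Qed.

Local Notation par := (par rho).

Lemma f0_fix z : (4 <= z)%N -> f 0 z = z.
Proof. by case: z => [|[|[|[|]]]]. Qed.
Lemma f1_fix z : (5 <= z)%N -> f 1 z = z.
Proof. by case: z => [|[|[|[|[|]]]]]. Qed.
Lemma f2_fix z : (6 <= z)%N -> f 2 z = z.
Proof. by case: z => [|[|[|[|[|[|]]]]]]. Qed.
Lemma f3_fix z : (z < 5)%N -> f 3 z = z.
Proof. by case: z => [|[|[|[|[|]]]]]. Qed.
Lemma f4_fix z : (z < 6)%N -> f 4 z = z.
Proof. by case: z => [|[|[|[|[|[|]]]]]]. Qed.
Lemma f3E z : (5 <= z <= N)%N -> f 3 z = if z == N then z else if odd z then z.+1 else z.-1.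
Proof. rewrite /rho_fun /tail_fun => hz; do !case: ifP => //; lia. Qed.
Lemma f4E z : (6 <= z <= N)%N -> f 4 z = if odd z then z.-1 else z.+1.
Proof. rewrite /rho_fun /tail_fun => hz; do !case: ifP => //; lia. Qed.

Lemma f_involutive k z : (k < 5)%N -> (z <= N)%N -> f k (f k z) = z.
Proof.
case: k => [|[|[|[|[|//]]]]] _ hz.
- by case: z hz => [|[|[|[|z]]]].
- by case: z hz => [|[|[|[|[|z]]]]].
- by case: z hz => [|[|[|[|[|[|z]]]]]].
- by rewrite /rho_fun /tail_fun; do !case: ifP => //; lia.
- by rewrite /rho_fun /tail_fun; do !case: ifP => //; lia.
Qed.

Lemma f3_ge z : (5 <= z)%N -> (5 <= f 3 z)%N.
Proof. by rewrite /rho_fun /tail_fun => hz; do !case: ifP => //; lia. Qed.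
Lemma f4_ge z : (6 <= z)%N -> (6 <= f 4 z)%N.
Proof. by rewrite /rho_fun /tail_fun => hz; do !case: ifP => //; lia. Qed.

Lemma f_comm i j z : (i.+1 < j < 5)%N -> f i (f j z) = f j (f i z).
Proof.
have [z6|z6] := ltnP z 6.
  case: i => [|[|[|//]]]; case: j => [|[|[|[|[|//]]]]] // _;
   case: z z6 => [|[|[|[|[|[|z]]]]]] // _; rewrite ?f4_fix //= ?f3_fix //=.
  exact: f0_fix (ltnW (f3_ge (isT : 5 <= 5)%N)).
  exact: f1_fix (f3_ge (isT : 5 <= 5)%N).
have f3z := f3_ge (ltnW z6); have f4z := f4_ge z6.
case: i => [|[|[|//]]]; case: j => [|[|[|[|[|//]]]]] // _;
  by rewrite ?(f0_fix, f1_fix, f2_fix) //; lia.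
Qed.

Lemma rho_pt k z : (k < 5)%N -> (z <= N)%N -> rho k (pt z) = pt (f k z).
Proof.
move=> k5 zN; apply: val_inj; have := rho_val (pt z) k5.
by rewrite /= (inordK (zN : z < N.+1)%N) => E; rewrite inordK -E.
Qed.

Lemma rho_fix k (x : 'I_N.+1) : (k < 5)%N -> f k x = x -> rho k x = x.
Proof. by move=> k5 fx; apply: val_inj; rewrite /= rho_val. Qed.

Lemma rhoK k : (k < 5)%N -> rho k * rho k = 1.
Proof.
move=> k5; apply/permP=> x; apply: val_inj.
by rewrite permM perm1 /= !rho_val // f_involutive // -ltnS.
Qed.

Lemma rho_comm i j : (i.+1 < j < 5)%N -> commute (rho i) (rho j).
Proof.
move=> ij; apply/permP=> x; apply: val_inj.
have [i5 j5] : (i < 5 /\ j < 5)%N by lia.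
by rewrite !permM /= !(rho_val _ i5, rho_val _ j5); apply/esym/f_comm.
Qed.

Lemma rho_neq1 k : (k < 5)%N -> rho k != 1.
Proof.
move=> k5; apply/eqP => /permP E.
have {}E z : (z <= N)%N -> f k z = z.
  move=> zN; have := congr1 val (E (pt z)).
  by rewrite perm1 /= rho_val // inordK.
case: k k5 E => [|[|[|[|[|//]]]]] _ E.
- by have := E 0 isT.
- have := E 1%N; move/(_ ltac:(lia)); by [].
- have := E 2; move/(_ ltac:(lia)); by [].
- have := E 5; move/(_ ltac:(lia)); rewrite f3E /=; [case: ifP|]; lia.
- have := E 6; move/(_ ltac:(lia)); rewrite f4E /=; lia.
Qed.

Lemma sggi_rho : is_sggi 5 rho.
Proof.
split=> [i i5 | i j i5 j5 ij].
  by apply: nt_prime_order => //; [exact: rhoK | exact: rho_neq1].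
rewrite expgMn; last by apply: rho_comm; rewrite j5 andbT; lia.
by rewrite ![_ ^+ 2]rhoK // mulg1.
Qed.

Lemma par_fix (b0 b1 b2 b3 b4 : bool) g (x : 'I_N.+1) : g \in par b0 b1 b2 b3 b4 ->
    (b0 -> f 0 x = x) -> (b1 -> f 1 x = x) -> (b2 -> f 2 x = x) ->
    (b3 -> f 3 x = x) -> (b4 -> f 4 x = x) ->
  g x = x.
Proof.
move=> gP *; apply: gens_fix gP.
by apply: forall_ord5; rewrite inE inordK //= => ?; apply: rho_fix; auto.
Qed.

Lemma par_stable (P : pred nat) (b0 b1 b2 b3 b4 : bool) g (x : 'I_N.+1) :
    g \in par b0 b1 b2 b3 b4 ->
    (forall z, P z -> [/\ b0 -> P (f 0 z), b1 -> P (f 1 z), b2 -> P (f 2 z),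
      b3 -> P (f 3 z) & b4 -> P (f 4 z)]) ->
  P x -> P (g x).
Proof.
move=> gP Pf Px; apply: (@gens_stable _ _ _ _ (fun x : 'I_N.+1 => P x) _ _ _ gP Px).
move=> i y; move: i; apply: forall_ord5; rewrite inE inordK //= => b Py;
 rewrite rho_val //; by case: (Pf _ Py); auto.
Qed.

(** * Dihedral orbits on the path and the orders of products of neighbours *)

(** The orbit of the end [hi], fixed by [rho i], is closed under both reflections, and from each
    point above [lo] one of them steps down by one. *)
Lemma rho_path_porbit i j lo hi :
    (i < 5)%N -> (j < 5)%N -> (lo <= hi <= N)%N -> f i hi = hi ->
    (forall z, (lo <= z < hi)%N -> f i z.+1 = z \/ f j z.+1 = z) ->
    (forall z, (lo <= z <= hi)%N -> (lo <= f i z <= hi)%N && (lo <= f j z <= hi)%N) ->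
  porbit (rho i * rho j) (pt hi) = [set x : 'I_N.+1 | lo <= x <= hi]%N.
Proof.
move=> i5 j5 hN fhi fS frange; apply/setP=> x; rewrite inE; apply/idP/idP.
  have hiP : (fun x : 'I_N.+1 => (lo <= x <= hi)%N) (pt hi) by rewrite inordK; lia.
  case/porbitP=> k ->; rewrite permX; elim: k => //= k IHk.
  rewrite permM; set y := iter _ _ _ in IHk *.
  have /andP[h1 _] := frange _ IHk; rewrite -rho_val // in h1.
  by have /andP[_ h2] := frange _ h1; rewrite -rho_val // in h2.
have sE : rho i (pt hi) = pt hi by apply: rho_fix => //; rewrite inordK //; lia.
have closed := dihedral_porbit_closed (rhoK i5) (rhoK j5) sE.
have reach d : (d <= hi - lo)%N -> pt (hi - d) \in porbit (rho i * rho j) (pt hi).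
  elim: d => [|d IHd] hd; first by rewrite subn0 porbit_id.
  have [H1 H2] := closed _ (IHd (ltnW hd)).
  have Ed : (hi - d = (hi - d.+1).+1)%N by lia.
  rewrite Ed !rho_pt // -?Ed in H1 H2; try lia.
  rewrite Ed in H1 H2.
  by case: (fS (hi - d.+1)%N) => [|E|E]; [lia | rewrite E in H1 | rewrite E in H2].
move=> hx; have := reach (hi - x)%N; rewrite subKn; last by case/andP: hx.
by rewrite inord_val; apply; case/andP: hx => *; apply: leq_sub2l.
Qed.

Lemma card_ord_interval lo hi : (lo <= hi <= N)%N ->
  #|[set x : 'I_N.+1 | lo <= x <= hi]%N| = (hi - lo).+1.
Proof.
move=> h; rewrite -(card_ord (hi - lo).+1).
have inj : injective (fun i : 'I_(hi - lo).+1 => pt (lo + i)).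
  move=> i k /(congr1 val); rewrite /= !inordK; try (have := ltn_ord i; have := ltn_ord k; lia).
  by move=> E; apply: val_inj => /=; lia.
rewrite -(card_imset _ inj); apply: eq_card => x; rewrite inE.
apply/idP/imsetP => [hx|[i _ ->]].
  have hi' : (x - lo < (hi - lo).+1)%N by lia.
  exists (Ordinal hi') => //; apply: val_inj; rewrite /= inordK; lia.
rewrite inordK; have := ltn_ord i; lia.
Qed.

Lemma porbit01 : porbit (rho 0 * rho 1%N) (pt 4) = [set x : 'I_N.+1 | 0 <= x <= 4]%N.
Proof.
apply: rho_path_porbit => //; first by lia.
  by move=> [|[|[|[|[|z]]]]] //; [left|right|left|right].
by move=> [|[|[|[|[|z]]]]].
Qed.

Lemma porbit12 : porbit (rho 1%N * rho 2) (pt 5) = [set x : 'I_N.+1 | 1 <= x <= 5]%N.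
Proof.
apply: rho_path_porbit => //; first by lia.
  by move=> [|[|[|[|[|[|z]]]]]] //; [left|right|left|right].
by move=> [|[|[|[|[|[|z]]]]]].
Qed.

Lemma porbit34 : porbit (rho 3 * rho 4) (pt N) = [set x : 'I_N.+1 | 5 <= x <= N]%N.
Proof.
apply: rho_path_porbit => //; first by lia.
- rewrite f3E ?eqxx //; lia.
- move=> z hz; have [oz|oz] := boolP (odd z); [left | right].
    rewrite f3E; last lia; do !case: ifP; lia.
  rewrite f4E; last lia; do !case: ifP; lia.
move=> z hz; rewrite f3E //; have [->|z5] := eqVneq z 5.
  rewrite f4_fix //=; do !case: ifP => //; lia.
rewrite f4E; last lia; do !case: ifP; lia.
Qed.

Lemma rho_moved k (x : 'I_N.+1) lo hi : (k < 5)%N ->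
  (forall z, (z <= N)%N -> ~~ (lo <= z <= hi)%N -> f k z = z) ->
  rho k x != x -> x \in [set x : 'I_N.+1 | lo <= x <= hi]%N.
Proof.
move=> k5 fk; apply: contraR; rewrite inE => hx; apply/eqP/rho_fix => //.
by apply: fk => //; rewrite -ltnS.
Qed.

Lemma moved_porbit01 x : rho 0 x != x \/ rho 1%N x != x -> x \in porbit (rho 0 * rho 1%N) (pt 4).
Proof.
by rewrite porbit01 => -[]; apply: rho_moved => // z zN h; [apply: f0_fix | apply: f1_fix]; lia.
Qed.

Lemma moved_porbit12 x : rho 1%N x != x \/ rho 2 x != x -> x \in porbit (rho 1%N * rho 2) (pt 5).
Proof.
rewrite porbit12 => -[]; apply: rho_moved => // -[//|z] zN h.
  by apply: f1_fix; lia.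
by apply: f2_fix; lia.
Qed.

Lemma moved_porbit34 x : rho 3 x != x \/ rho 4 x != x -> x \in porbit (rho 3 * rho 4) (pt N).
Proof.
by rewrite porbit34 => -[]; apply: rho_moved => // z zN h; [apply: f3_fix | apply: f4_fix]; lia.
Qed.

Lemma rho1_fix5 : rho 1%N (pt 5) = pt 5. Proof. by rewrite rho_pt //; lia. Qed.
Lemma rho3_fixN : rho 3 (pt N) = pt N. Proof. by rewrite rho_pt // f3E ?eqxx //; lia. Qed.

Lemma order01 : #[rho 0 * rho 1%N] = 5.
Proof. by rewrite (dihedral_order moved_porbit01) porbit01 card_ord_interval //; lia. Qed.

Lemma order12 : #[rho 1%N * rho 2] = 5.
Proof. by rewrite (dihedral_order moved_porbit12) porbit12 card_ord_interval //; lia. Qed.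

Lemma order34 : #[rho 3 * rho 4] = (N - 4)%N.
Proof. by rewrite (dihedral_order moved_porbit34) porbit34 card_ord_interval //; lia. Qed.

(** * The twist [tau] and the order of [rho 2 * rho 3] *)

Definition tau := tperm (pt 5) (pt 6) * rho 3.

Lemma tau_val (x : 'I_N.+1) : tau x = (if (x <= 6)%N then nat_of_ord x else f 3 x) :> nat.
Proof.
rewrite permM rho_val // tperm_val //; try lia.
have [x6|x6] := leqP x 6; last by do !case: ifP => //; lia.
move: (nat_of_ord x) x6 => z z6; have [->|z5] := eqVneq z 5.
  by rewrite f3E; [do !case: ifP => //|]; lia.
have [->|z6'] := eqVneq z 6; first by rewrite f3E; [do !case: ifP => //|]; lia.
by rewrite f3_fix //; lia.
Qed.

Lemma rho3_tau : rho 3 = tperm (pt 5) (pt 6) * tau.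
Proof. by rewrite mulgA tperm2 mul1g. Qed.

Lemma tauK : tau * tau = 1.
Proof.
apply/permP=> x; apply: val_inj; rewrite permM perm1 /= !tau_val.
have [x6|x6] := leqP x 6; first by rewrite x6.
have := ltn_ord x; rewrite ltnS => xN.
rewrite f_involutive // f3E; last lia.
by do !case: ifP => //; lia.
Qed.

(** The supports are disjoint, [tau] moving only points from 7 on. *)
Lemma tau_comm (s : {perm 'I_N.+1}) :
  (forall x : 'I_N.+1, (7 <= x)%N -> s x = x) -> commute s tau.
Proof.
move=> sfix; have tau_lt (x : 'I_N.+1) : (x < 7)%N -> tau x = x.
  by move=> x7; apply: val_inj; rewrite /= tau_val -ltnS x7.
have tau_ge (x : 'I_N.+1) : (7 <= x)%N -> (7 <= tau x)%N.
  move=> x7; rewrite tau_val f3E; first by do !case: ifP => //; lia.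
  by have := ltn_ord x; lia.
apply/permP=> x; rewrite [LHS]permM [RHS]permM; have [x7|x7] := ltnP x 7.
  rewrite (tau_lt x) //.
  have [sx7|sx7] := leqP 7 (s x); last by rewrite tau_lt.
  by rewrite (perm_inj (sfix _ sx7)) tau_lt.
by rewrite !sfix // tau_ge.
Qed.

(** The even generators [rho 0], [rho 1], [rho 2] have this form with exponent 0, and [rho 3] has it
    with [s] = (5 6). Products keep it: [tau] is an involution commuting with each such [s], so
    exponents add modulo 2 as signs do. *)
Lemma par0123P g : g \in par true true true true false ->
  exists2 s : {perm 'I_N.+1},
    forall x : 'I_N.+1, (7 <= x)%N -> s x = x & g = s * tau ^+ odd_perm s.
Proof.
pose P (g : {perm 'I_N.+1}) := exists2 s : {perm 'I_N.+1},
  forall x : 'I_N.+1, (7 <= x)%N -> s x = x & g = s * tau ^+ odd_perm s.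
move: g.
apply: (@gen_ind _ _ P) => [|g _ [s sfix ->] /imsetP[i iJ ->]].
  by exists 1 => [x _|]; rewrite ?perm1 // odd_perm1 mulg1.
have [t tfix ->] : P (rho i).
  case: i iJ => -[|[|[|[|[|i]]]]] // hi; rewrite inE => // _ /=.
  - exists (rho 0); last by rewrite rho_even // mulg1.
    by move=> x x7; apply: rho_fix => //; apply: f0_fix; lia.
  - exists (rho 1%N); last by rewrite rho_even // mulg1.
    by move=> x x7; apply: rho_fix => //; apply: f1_fix; lia.
  - exists (rho 2); last by rewrite rho_even // mulg1.
    by move=> x x7; apply: rho_fix => //; apply: f2_fix; lia.
  exists (tperm (pt 5) (pt 6)) => [x x7|].
    by apply: val_inj; rewrite /= tperm_val; try lia; do !case: ifP => //; lia.
  rewrite {1}rho3_tau odd_tperm -val_eqE /= !inordK ?expg1 //; lia.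
exists (s * t) => [x x7|]; first by rewrite permM sfix ?tfix.
rewrite odd_permM mulgA -(mulgA s) -(commuteX (odd_perm s) (tau_comm tfix)).
rewrite !mulgA -!(mulgA (s * t)); congr (_ * _); case: (odd_perm s); case: (odd_perm t);
 rewrite /= ?mulg1 ?mul1g //.
exact: tauK.
Qed.

Lemma tperm_commute a b c d : (a < b < c)%N -> (c < d <= N)%N ->
  commute (tperm (pt a) (pt b)) (tperm (pt c) (pt d)).
Proof.
move=> abc cd; apply: commute_tperm; apply: val_inj; rewrite /= tperm_val ?inordK; try lia;
 do !case: ifP => //; lia.
Qed.

(** [rho 2 * rho 3] is the product of the commuting permutations (2 3), a 3-cycle on 4, 5, 6, and
    [tau]; cubing kills the 3-cycle and keeps the two involutions. *)
Lemma rho23_cube : (rho 2 * rho 3) ^+ 3 = tperm (pt 2) (pt 3) * tau.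
Proof.
pose d : {perm 'I_N.+1} := tperm (pt 4) (pt 5) * tperm (pt 5) (pt 6).
have -> : rho 2 * rho 3 = tperm (pt 2) (pt 3) * (d * tau).
  by rewrite rho2E rho3_tau !mulgA.
have d3 : d ^+ 3 = 1.
  apply/permP=> x; apply: val_inj; rewrite !expgS expg0 mulg1 !permM perm1 /=.
  by rewrite !tperm_val; try lia; case: (nat_of_ord x) => [|[|[|[|[|[|[|z]]]]]]].
have dfix (x : 'I_N.+1) : (7 <= x)%N -> d x = x.
  move=> x7; apply: val_inj; rewrite permM /= !tperm_val; try lia.
  by do !case: ifP => //; lia.
have t23fix (x : 'I_N.+1) : (7 <= x)%N -> tperm (pt 2) (pt 3) x = x.
  move=> x7; apply: val_inj; rewrite /= !tperm_val; try lia.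
  by do !case: ifP => //; lia.
have taud := tau_comm dfix.
have tau23 := tau_comm t23fix.
rewrite expgMn; last by do 2?apply: commuteM => //; apply: tperm_commute; lia.
rewrite expgMn // d3 mul1g !expgS !expg0 !mulg1 tauK mulg1.
by rewrite tperm2 mulg1.
Qed.

(** The cube is an involution, so the order divides 6. The cube moves 2, and the square moves 4,
    which excludes the proper divisors. *)
Lemma order23 : #[rho 2 * rho 3] = 6.
Proof.
have c6 : (#[rho 2 * rho 3] %| 6)%N.
  rewrite order_dvdn (expgM _ 3 2) rho23_cube expgMn; last first.
    apply: tau_comm => // x x7; apply: val_inj; rewrite /= !tperm_val; try lia.
    by do !case: ifP => //; lia.
  by rewrite !expgS !expg0 !mulg1 tperm2 tauK // mulg1.
have c3 : ~~ (#[rho 2 * rho 3] %| 3)%N.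
  rewrite order_dvdn rho23_cube; apply/eqP => /permP/(_ (pt 2))/(congr1 val).
  by rewrite permM tpermL perm1 /= tau_val // !inordK //; lia.
have c2 : ~~ (#[rho 2 * rho 3] %| 2)%N.
  rewrite order_dvdn; apply/eqP => /permP/(_ (pt 4))/(congr1 val).
  have r24 : rho 2 (pt 4) = pt 5 by rewrite rho_pt //; lia.
  have r35 : rho 3 (pt 5) = pt 6.
    by rewrite rho_pt ?f3E //=; try lia; case: eqP => //; lia.
  have r26 : rho 2 (pt 6) = pt 6 by rewrite rho_pt //; lia.
  have r36 : rho 3 (pt 6) = pt 5.
    by rewrite rho_pt ?f3E //=; try lia; case: eqP => //; lia.
  by rewrite expgS expg1 !permM perm1 r24 r35 r26 r36 /= !inordK //; lia.
have := dvdn_leq (isT : 0 < 6)%N c6.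
by move: c6 c3 c2; case: #[_] => [|[|[|[|[|[|[|k]]]]]]].
Qed.

Lemma par_even b0 b1 b2 b3 b4 g : g \in par b0 b1 b2 b3 b4 -> odd_perm g = false.
Proof.
move: g; apply: (@gen_ind _ _ (fun g : {perm 'I_N.+1} => odd_perm g = false)).
  exact: odd_perm1.
by move=> g _ g0 /imsetP[i _ ->]; rewrite odd_permM g0 rho_even.
Qed.

(** * Blocks and chains of links *)

Lemma par0234_block g (x : 'I_N.+1) : g \in par true false true true true ->
  block (g x) = block x.
Proof.
move=> gP; apply/eqP; apply: (par_stable (P := fun z => block z == block x) gP) => //.
move=> z; have [z6|z6] := ltnP z 6.
  move=> h; split=> // _.
  - by move: z z6 h => [|[|[|[|[|[|z]]]]]].
  - by move: z z6 h => [|[|[|[|[|[|z]]]]]].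
  - case: (ltnP z 5) => z5; first by rewrite f3_fix.
    have fz := f3_ge z5; move: h; rewrite /block; do !case: ifP => //; lia.
  - by rewrite f4_fix.
have f3z := f3_ge (ltnW z6); have f4z := f4_ge z6.
move=> h; split=> // _; rewrite ?f0_fix ?f2_fix //; try lia.
  by move: h; rewrite /block; do !case: ifP => //; lia.
by move: h; rewrite /block; do !case: ifP => //; lia.
Qed.

Section Linked.
Variables (H : {group {perm 'I_N.+1}}) (z : {perm 'I_N.+1}).
Local Notation linked i j := (twist_linked H z (pt i) (pt j)).

(** The listed links join up the blocks cut down to the first [m] points. It is applied with [m] = 6
    without [rho 3] and with [m] = 7 when [rho 3] supplies the link from 5 to 6. *)
Lemma block_linked m i j :
    linked 0 1%N -> linked 2 3 -> linked 4 5 -> (6 < m -> linked 5 6)%N -> (m <= 7)%N ->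
    (i < m)%N -> (j < m)%N -> block i = block j -> linked i j.
Proof.
move=> l01 l23 l45 l56 m7 im jm.
have refl k : linked k k by rewrite /twist_linked eqxx.
have [m6|m6] := ltnP 6 m.
  have {}l56 := l56 m6; have l46 := twist_linked_trans l45 l56.
  have {im} : (i < 7)%N by lia. have {jm} : (j < 7)%N by lia.
  by case: i => [|[|[|[|[|[|[|i]]]]]]] // ; case: j => [|[|[|[|[|[|[|j]]]]]]] // ;
     rewrite twist_linked_sym.
have {im} : (i < 6)%N by lia. have {jm} : (j < 6)%N by lia.
by case: i => [|[|[|[|[|[|i]]]]]] // ; case: j => [|[|[|[|[|[|j]]]]]] // ;
     rewrite twist_linked_sym.
Qed.

(** One step of a walk: conjugation by [rho k] keeps the hub [i] and the twist, and moves the other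
    end along an edge labelled [k]. *)
Lemma linked_rho k a b i :
    (k < 5)%N -> (a <= N)%N -> (i <= N)%N -> rho k \in H -> commute (rho k) z ->
    f k i = i -> f k a = b -> linked a i -> linked b i.
Proof.
move=> k5 aN iN Hk kz ki ka l.
by have := twist_linkedJ Hk kz l; rewrite !rho_pt // ki ka.
Qed.
End Linked.

(** * Discarding an isolated end generator *)

(** [rho 0] splits off as a commuting factor of order 2. It moves 0, which the other factor fixes,
    so its contribution is trivial. *)
Lemma drop_gen0 b2 b3 b4 g : g \in par true false b2 b3 b4 -> g ord0 = ord0 ->
  g \in par false false b2 b3 b4.
Proof.
rewrite (par_split1 rho_comm) => /mulsgP[a b aP bP ->].
rewrite permM => g0; have b0 : b ord0 = ord0 by apply: (par_fix bP); rewrite ?f3_fix ?f4_fix.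
have {}g0 : a ord0 = ord0 by apply: (@perm_inj _ b); rewrite g0.
have aC : a \in <[rho 0]>.
  by apply: subsetP aP; apply: par_subset => // _; apply: cycle_id.
have [->|a1] := cycle_involution (rhoK (isT : 0 < 5)%N) aC; first by rewrite mul1g.
by have := congr1 val g0; rewrite a1 /= rho_val.
Qed.

Lemma drop_gen4 b0 b1 b2 g : g \in par b0 b1 b2 false true -> g (pt N) = pt N ->
  g \in par b0 b1 b2 false false.
Proof.
rewrite (par_split3 rho_comm) => /mulsgP[a b aP bP ->].
rewrite permM => gN; have aN : a (pt N) = pt N.
  by apply: (par_fix aP); rewrite inordK // ?f0_fix ?f1_fix ?f2_fix //; lia.
rewrite aN in gN.
have bC : b \in <[rho 4]>.
  by apply: subsetP bP; apply: par_subset => // _; apply: cycle_id.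
have [->|b1'] := cycle_involution (rhoK (isT : 4 < 5)%N) bC; first by rewrite mulg1.
have f4N : f 4 N = N.-1 by rewrite f4E //; [case: ifP; lia | lia].
by move/(congr1 val): gN; rewrite b1' rho_pt // f4N /= !inordK //; lia.
Qed.

(** * Stabilisers in the groups on the first five and six points *)

(** The group is dihedral on the path 0, ..., 4, whose ends 4 and 0 are fixed by [rho 0] and [rho 1]
    respectively. *)
Lemma par01_stab a (x : 'I_N.+1) k :
    (k < 2)%N -> (x < 5)%N -> a \in par true true false false false ->
  a x = x -> f k x = x -> a \in <[rho k]>.
Proof.
move=> k2 x5 aP ax kx.
have aD : a \in <<[set rho 0; rho 1%N]>>.
  apply: subsetP aP; apply: par_subset => // _; apply: mem_gen; rewrite !inE eqxx ?orbT //.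
have rk : rho k x = x by apply: rho_fix => //; lia.
have xO : x \in porbit (rho 0 * rho 1%N) (pt 4) by rewrite porbit01 // inE; lia.
case: k k2 kx rk => [|[|//]] _ _ rk.
  by apply: (dihedral_stab _ _ moved_porbit01 xO) => //; apply: rhoK.
by apply: (dihedral_stabr _ _ moved_porbit01 xO) => //; apply: rhoK.
Qed.

(* The ten triples of the two-graph on six points preserved by <rho 0, rho 1, rho 2>,
   the triple x, y, z being coded by 2 ^ x + 2 ^ y + 2 ^ z. *)
Definition two_graph x y z :=
  (2 ^ x + 2 ^ y + 2 ^ z)%N \in
    [:: 2 ^ 0 + 2 ^ 1 + 2 ^ 2; 2 ^ 0 + 2 ^ 1 + 2 ^ 3; 2 ^ 0 + 2 ^ 2 + 2 ^ 4;
        2 ^ 0 + 2 ^ 3 + 2 ^ 5; 2 ^ 0 + 2 ^ 4 + 2 ^ 5; 2 ^ 1 + 2 ^ 2 + 2 ^ 5;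
        2 ^ 1 + 2 ^ 4 + 2 ^ 5; 2 ^ 1 + 2 ^ 3 + 2 ^ 4; 2 ^ 2 + 2 ^ 3 + 2 ^ 5;
        2 ^ 2 + 2 ^ 3 + 2 ^ 4]%N.

(** A finite computation. Triples with a repeated point give sums with fewer than three binary
    digits, so the code never confuses them with listed triples. *)
Lemma two_graph_gen k x y z : (k < 3)%N -> (x < 6)%N -> (y < 6)%N -> (z < 6)%N ->
  two_graph (f k x) (f k y) (f k z) = two_graph x y z.
Proof.
case: k => [|[|[|//]]] _; move: x => [|[|[|[|[|[|//]]]]]] _; move: y => [|[|[|[|[|[|//]]]]]] _;
  move: z => [|[|[|[|[|[|//]]]]]] _; vm_compute; reflexivity.
Qed.

Lemma par012_lt6 a (x : 'I_N.+1) : a \in par true true true false false -> (x < 6)%N -> (a x < 6)%N.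
Proof.
move=> aP; apply: (par_stable (P := fun z => (z < 6)%N) aP) => z z6.
by split=> // _; move: z z6 => [|[|[|[|[|[|]]]]]].
Qed.

Lemma par012_two_graph a (x y z : 'I_N.+1) : a \in par true true true false false ->
  (x < 6)%N -> (y < 6)%N -> (z < 6)%N -> two_graph (a x) (a y) (a z) = two_graph x y z.
Proof.
move=> aP x6 y6 z6; move: a aP.
(* Membership is carried along because invariance under a generator needs the images to stay below
   6. *)
pose P a := a \in par true true true false false /\ two_graph (a x) (a y) (a z) = two_graph x y z.
suff H a : a \in par true true true false false -> P a by move=> a /H[].
move: a; apply: (@gen_ind _ _ P) => [|a _ [aP IH] /imsetP[i iJ ->]].
  by rewrite /P group1 !perm1.
have i3 : (i < 3)%N by move: iJ; rewrite inE; case: i => -[|[|[|[|[|i]]]]].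
split; first by rewrite groupM // mem_gens.
by rewrite !permM !rho_val ?two_graph_gen ?par012_lt6 //; lia.
Qed.

(* In a group fixing 0, the pairs completing 0 to a triple of the two-graph form
   the pentagon 1 - 2 - 4 - 5 - 3 - 1, which leaves only the reflection in 5. *)
Lemma par012_fix05 d : d \in par true true true false false ->
    d (pt 0) = pt 0 -> d (pt 5) = pt 5 ->
  (d (pt 3) = pt 3 \/ d (pt 3) = pt 4) /\ (d (pt 3) = pt 3 -> d = 1).
Proof.
have lt6 (i : nat) : (i < 6)%N -> (i < N.+1)%N by lia.
move=> dP d0 d5.
have tg i j l : (i < 6)%N -> (j < 6)%N -> (l < 6)%N ->
    two_graph (d (pt i)) (d (pt j)) (d (pt l)) = two_graph i j l.
  by move=> i6 j6 l6; rewrite par012_two_graph // ?inordK ?lt6.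
have dlt i : (i < 6)%N -> (d (pt i) < 6)%N by move=> i6; rewrite par012_lt6 // inordK ?lt6.
have dneq i j : (i < 6)%N -> (j < 6)%N -> i != j -> d (pt i) != d (pt j) :> nat.
  by move=> i6 j6; rewrite val_eqE (inj_eq perm_inj) -val_eqE /= !inordK ?lt6.
have dE i : d (pt i) = pt i -> (i < 6)%N -> d (pt i) = i :> nat.
  by move=> -> i6; rewrite inordK ?lt6.
have {d0 d5} [d0 d5] := (dE 0 d0 isT, dE 5 d5 isT).
split.
  suff H : d (pt 3) = 3 :> nat \/ d (pt 3) = 4 :> nat.
    by case: H => E; [left | right]; apply: val_inj; rewrite /= inordK ?lt6.
  (* The neighbours of 5 in the pentagon are 3 and 4. *)
  move: (dlt 3 isT) (tg 0 3 5 isT isT isT); rewrite d0 d5.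
  by case: (nat_of_ord (d (pt 3))) => [|[|[|[|[|[|]]]]]] //; [left | right].
move=> d3; have {}d3 := dE 3 d3 isT.
(* Walk round the pentagon: 4 is the other neighbour of 5, then 1 that of 3, and 2 that of 4. *)
have d4 : d (pt 4) = 4 :> nat.
  have := tg 0 4 5 isT isT isT; have := dneq 3 4 isT isT isT; have := dlt 4 isT.
  by rewrite d0 d5 d3; case: (nat_of_ord (d (pt 4))) => [|[|[|[|[|[|]]]]]].
have d1 : d (pt 1%N) = 1%N :> nat.
  have := tg 0 1%N 3 isT isT isT; have := dneq 1%N 5 isT isT isT; have := dlt 1%N isT.
  by rewrite d0 d5 d3; case: (nat_of_ord (d (pt 1%N))) => [|[|[|[|[|[|]]]]]].
have d2 : d (pt 2) = 2 :> nat.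
  have := tg 0 2 4 isT isT isT; have := dneq 2 5 isT isT isT; have := dlt 2 isT.
  by rewrite d0 d5 d4; case: (nat_of_ord (d (pt 2))) => [|[|[|[|[|[|]]]]]].
apply/permP=> x; rewrite perm1; have [x6|x6] := ltnP x 6; last first.
  by apply: (par_fix dP); rewrite ?f0_fix ?f1_fix ?f2_fix //; lia.
apply: val_inj; rewrite /= -[x in LHS]inord_val.
by move: (nat_of_ord x) x6 => [|[|[|[|[|[|]]]]]].
Qed.

(** [<rho 1, rho 2>] fixes 0 and its rotations are transitive on 1, ..., 5, so one of them corrects
    [a] to fix 5. If 3 then goes to 4, a further factor [rho 1], which fixes 5 and swaps 3 and 4,
    makes 3 fixed as well, and the corrected element is trivial. *)
Lemma par012_fix0 a : a \in par true true true false false -> a ord0 = ord0 ->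
  a \in par false true true false false.
Proof.
move=> aP a0; set K := par false _ _ _ _.
have sKP : K \subset par true true true false false by apply: parS.
have fixK c : c \in K -> c ord0 = ord0.
  by move=> cK; apply: (par_fix cK).
have r1K : rho 1%N \in K by apply: mem_par.
have r2K : rho 2 \in K by apply: mem_par.
suff [c cK ac] : exists2 c, c \in K & a * c \in K.
  by rewrite -(groupMr _ cK).
have pt0 : pt 0 = ord0 by apply: val_inj; rewrite /= inordK.
have acP c : c \in K -> a * c \in par true true true false false.
  by move=> cK; rewrite groupM // (subsetP sKP).
have ac0 c : c \in K -> (a * c) (pt 0) = pt 0.
  by move=> cK; rewrite permM pt0 a0 fixK.
have [c cK ac5] : exists2 c, c \in K & (a * c) (pt 5) = pt 5.
  have : a (pt 5) \in porbit (rho 1%N * rho 2) (pt 5).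
    have a6 : (a (pt 5) < 6)%N by rewrite par012_lt6 ?inordK //; lia.
    rewrite porbit12 // inE [X in _ && X]a6 andbT lt0n.
    apply: contraTneq isT => a5.
    have : a (pt 5) = a ord0 by rewrite a0; apply: val_inj.
    by move/perm_inj/(congr1 val); rewrite /= inordK //; lia.
  case/porbitP=> k a5; exists ((rho 1%N * rho 2) ^- k).
    by rewrite groupV groupX // groupM.
  by rewrite permM a5 permK.
have [[ac3|ac3] fix1] := par012_fix05 (acP _ cK) (ac0 _ cK) ac5.
  by exists c => //; rewrite (fix1 ac3) group1.
have cK' : c * rho 1%N \in K by rewrite groupM.
exists (c * rho 1%N) => //.
have d5 : (a * (c * rho 1%N)) (pt 5) = pt 5 by rewrite mulgA permM ac5 rho1_fix5.
have d3 : (a * (c * rho 1%N)) (pt 3) = pt 3 by rewrite mulgA permM ac3 rho_pt //; lia.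
have [_ d1] := par012_fix05 (acP _ cK') (ac0 _ cK') d5.
by rewrite (d1 d3) group1.
Qed.

(** * Discarding a generator that has a neighbour *)

(** The factor in [rho 3], [rho 4] fixes 0, so the dihedral factor stabilises its end 0 and lies in
    [<[rho 1]>]. *)
Lemma drop_gen0_of01 b3 b4 g : g \in par true true false b3 b4 -> g ord0 = ord0 ->
  g \in par false true false b3 b4.
Proof.
rewrite (par_split2 rho_comm) => /mulsgP[a b aP bP ->].
rewrite permM => g0; have b0 : b ord0 = ord0.
  exact: (par_fix bP).
have a0 : a ord0 = ord0 by apply: (@perm_inj _ b); rewrite g0.
have aC : a \in <[rho 1%N]> by apply: (par01_stab _ _ aP a0).
rewrite groupM //; last by apply: subsetP bP; apply: parS.
by apply: subsetP aC; rewrite cycle_subG mem_par.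
Qed.

(** The dihedral factor sends 4 to a point below 5, which the other factor fixes. The bound then
    forces that point to be the end 4, whose stabiliser is [<[rho 0]>]. *)
Lemma drop_gen1_of01 b3 b4 g : g \in par true true false b3 b4 -> (4 <= g (pt 4))%N ->
  g \in par true false false b3 b4.
Proof.
rewrite (par_split2 rho_comm) => /mulsgP[a b aP bP ->].
rewrite permM => g4; have a5 : (a (pt 4) < 5)%N.
  apply: (par_stable (P := fun z => (z < 5)%N) aP); last by rewrite inordK //; lia.
  by move=> z z5; split=> // _; move: z z5 => [|[|[|[|[|]]]]].
have bfix : b (a (pt 4)) = a (pt 4).
  by apply: (par_fix bP) => // _; [apply: f3_fix | apply: f4_fix]; lia.
have a4 : a (pt 4) = pt 4.
  by apply: val_inj; rewrite bfix in g4; rewrite /= inordK; lia.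
have aC : a \in <[rho 0]>.
  by apply: (par01_stab _ _ aP a4); rewrite // inordK //; lia.
rewrite groupM //; last by apply: subsetP bP; apply: parS.
by apply: subsetP aC; rewrite cycle_subG mem_par.
Qed.

Lemma par34_dihedral b : b \in par false false false true true -> b \in <<[set rho 3; rho 4]>>.
Proof.
by move=> bP; apply: subsetP bP; apply: par_subset => // _; apply: mem_gen; rewrite !inE eqxx ?orbT.
Qed.

Lemma drop_gen4_of34 b0 b1 g : g \in par b0 b1 false true true -> g (pt N) = pt N ->
  g \in par b0 b1 false true false.
Proof.
rewrite (par_split2 rho_comm) => /mulsgP[a b aP bP ->].
rewrite permM; have -> : a (pt N) = pt N.
  by apply: (par_fix aP) => // _; rewrite inordK //; [apply: f0_fix | apply: f1_fix]; lia.
move=> bN; have bC : b \in <[rho 3]>.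
  apply: (dihedral_stab _ _ moved_porbit34  _ (par34_dihedral bP) bN); rewrite ?rhoK //.
  - exact: porbit_id.
  - exact: rho3_fixN.
rewrite groupM //; first by apply: subsetP aP; apply: parS.
by apply: subsetP bC; rewrite cycle_subG mem_par.
Qed.

(** The dihedral factor keeps 5 among the points from 5 on, so the bound makes it fix the end 5,
    whose stabiliser is [<[rho 4]>]. *)
Lemma drop_gen3_of34 b0 b1 g : g \in par b0 b1 false true true -> (g (pt 5) < 6)%N ->
  g \in par b0 b1 false false true.
Proof.
rewrite (par_split2 rho_comm) => /mulsgP[a b aP bP ->].
have pt5 : pt 5 = 5 :> nat by rewrite inordK //; lia.
rewrite permM; have -> : a (pt 5) = pt 5.
  by apply: (par_fix aP) => // _; rewrite pt5.
move=> b6; have b5 : b (pt 5) = pt 5.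
  have b5 : (5 <= b (pt 5))%N.
    apply: (par_stable (P := fun z => (5 <= z)%N) bP); last by rewrite pt5.
    move=> z z5; split=> // _; first exact: f3_ge.
    have [z6|z6] := ltnP z 6; first by rewrite f4_fix.
    by apply: ltnW; apply: f4_ge.
  by apply: val_inj; rewrite /= pt5; lia.
have bC : b \in <[rho 4]>.
  apply: (dihedral_stabr _ _ moved_porbit34 _ (par34_dihedral bP) b5); rewrite ?rhoK //.
    by rewrite porbit34 // inE pt5; lia.
  by rewrite rho_pt //; lia.
rewrite groupM //; first by apply: subsetP aP; apply: parS.
by apply: subsetP bC; rewrite cycle_subG mem_par.
Qed.

Lemma drop_gen0_of0124 g : g \in par true true true false true -> g ord0 = ord0 ->
  g \in par false true true false true.
Proof.
rewrite (par_split3 rho_comm) => /mulsgP[a b aP bP ->].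
rewrite permM => g0; have b0 : b ord0 = ord0.
  exact: (par_fix bP).
have a0 : a ord0 = ord0 by apply: (@perm_inj _ b); rewrite g0.
rewrite groupM //; last by apply: subsetP bP; apply: parS.
by apply: subsetP (par012_fix0 aP a0); apply: parS.
Qed.

Lemma pt_link (H : {group {perm 'I_N.+1}}) z i j :
  tperm (pt i) (pt j) * z \in H -> twist_linked H z (pt i) (pt j).
Proof. by rewrite /twist_linked => ->; rewrite orbT. Qed.

Lemma drop_gen1_of0124 g : g \in par true true true false true ->
    (forall x : 'I_N.+1, block (g x) = block x) ->
  g \in par true false true false true.
Proof.
rewrite (par_split3 rho_comm) => /mulsgP[a b aP bP ->] blk.
have a6 (x : 'I_N.+1) : (x < 6)%N -> (a x < 6)%N by apply: par012_lt6.
have a_block (x : 'I_N.+1) : (x < 6)%N -> block (a x) = block x.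
  move=> x6; rewrite -[RHS]blk permM (par_fix bP) // => _.
  by apply: f4_fix; apply: a6.
rewrite groupM //; last by apply: subsetP bP; apply: parS.
suff: a \in par true false true false false by apply: subsetP; apply: parS.
have r0 : rho 0 \in par true false true false false by apply: mem_par.
have r2 : rho 2 \in par true false true false false by apply: mem_par.
(* The twist is (4 5) and disappears because [a] is even. The links come from [rho 0 * rho 2] = (0
   1)(4 5), [rho 2] = (2 3)(4 5) and (4 5)(4 5) = 1. *)
have := @twisted_perm_mem _ [group of par true false true false false] (tperm (pt 4) (pt 5)) a.
rewrite (par_even aP) mulg1; apply=> x.
have [x6|x6] := ltnP x 6; last first.
  rewrite /twist_linked (par_fix aP) ?eqxx // => _;
   by rewrite ?f0_fix ?f1_fix ?f2_fix //; lia.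
rewrite -[a x]inord_val -{1}[x]inord_val.
apply: (@block_linked _ _ 6) => //; rewrite ?a_block ?a6 //; apply: pt_link.
- suff -> : tperm (pt 0) (pt 1%N) * tperm (pt 4) (pt 5) = rho 0 * rho 2 by apply: groupM.
  by rewrite rho0E rho2E !mulgA -(mulgA _ _ (tperm (pt 2) _)) tperm2 mulg1.
- by rewrite -rho2E.
- by rewrite tperm2 group1.
Qed.

Lemma par0123_moved (g s : {perm 'I_N.+1}) :
    (forall x : 'I_N.+1, (7 <= x)%N -> s x = x) -> g = s * tau ^+ odd_perm s ->
  forall x : 'I_N.+1, (x < 7)%N -> (s x < 7)%N /\ g x = s x.
Proof.
move=> sfix -> x x7; have sx7 : (s x < 7)%N.
  by rewrite ltnNge; apply/negP => h; have /perm_inj sx := sfix _ h; rewrite sx leqNgt x7 in h.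
split=> //; rewrite permM; case: odd_perm; rewrite ?perm1 //.
by apply: val_inj; rewrite /= tau_val // -ltnS sx7.
Qed.

Lemma drop_gen1_of0123 g : g \in par true true true true false ->
    (forall x : 'I_N.+1, block (g x) = block x) ->
  g \in par true false true true false.
Proof.
case/par0123P=> s sfix gE blk; rewrite gE.
have s_lt7 := par0123_moved sfix gE.
set H := par _ _ _ _ _.
have r0 : rho 0 \in H by apply: mem_par.
have r2 : rho 2 \in H by apply: mem_par.
have r3 : rho 3 \in H by apply: mem_par.
(* The cube isolates (2 3) [tau]; left multiplication by [rho 0] and [rho 2] turns it into (0 1)
   [tau] and (4 5) [tau], while [rho 3] is (5 6) [tau]. *)
have l23 : tperm (pt 2) (pt 3) * tau \in H by rewrite -rho23_cube // groupX // groupM.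
apply: (@twisted_perm_mem _ [group of H]) => x.
have [x7|x7] := ltnP x 7; last by rewrite /twist_linked sfix ?eqxx.
have [sx7 gx] := s_lt7 x x7.
rewrite -[s x]inord_val -{1}[x]inord_val.
apply: (@block_linked _ _ 7) => //; last by rewrite -gx blk.
- apply: pt_link; suff -> : tperm (pt 0) (pt 1%N) * tau = rho 0 * (tperm (pt 2) (pt 3) * tau)
    by apply: groupM.
  by rewrite rho0E !mulgA -(mulgA _ _ (tperm (pt 2) _)) tperm2 mulg1.
- exact: pt_link.
- apply: pt_link; suff -> : tperm (pt 4) (pt 5) * tau = rho 2 * (tperm (pt 2) (pt 3) * tau)
    by apply: groupM.
  rewrite rho2E tperm_commute //; last lia.
  by rewrite !mulgA -(mulgA _ _ (tperm (pt 2) _)) tperm2 mulg1.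
- by move=> _; apply: pt_link; rewrite -rho3_tau.
Qed.

Lemma drop_gen0_of0123 g : g \in par true true true true false -> g ord0 = ord0 ->
  g \in par false true true true false.
Proof.
case/par0123P=> s sfix gE g0; rewrite gE.
have s_lt7 := par0123_moved sfix gE.
set H := par _ _ _ _ _.
have r1 : rho 1%N \in H by apply: mem_par.
have r2 : rho 2 \in H by apply: mem_par.
have r3 : rho 3 \in H by apply: mem_par.
have tauC k : (k < 3)%N -> commute (rho k) tau.
  move=> k3; apply: tau_comm => // x x7; apply: rho_fix => //; first lia.
  by case: k k3 => [|[|[|//]]] _; [apply: f0_fix | apply: f1_fix | apply: f2_fix]; lia.
have l6 : twist_linked H tau (pt 6) (pt 6) by rewrite /twist_linked eqxx.
have l5 : twist_linked H tau (pt 5) (pt 6) by apply: pt_link; rewrite -rho3_tau.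
have leN k : (k <= 9)%N -> (k <= N)%N by move=> /leq_trans->.
have step k i j : (k < 3)%N -> rho k \in H -> (i <= N)%N -> f k i = j ->
    twist_linked H tau (pt i) (pt 6) -> twist_linked H tau (pt j) (pt 6).
  move=> k3 Hk iN; apply: (linked_rho (leq_trans k3 _) iN (leN 6 _) Hk (tauC k k3)) => //.
  by case: k k3 {Hk} => [|[|[|]]].
(* Alternating [rho 2] and [rho 1], which fix 6 and commute with [tau], walks the link with 6 from 5
   down to 1. The remaining point 0 is fixed by [s]. *)
have l4 := step 2 5 4 isT r2 (leN 5 isT) erefl l5.
have l3 := step 1%N 4 3 isT r1 (leN 4 isT) erefl l4.
have l2 := step 2 3 2 isT r2 (leN 3 isT) erefl l3.
have l1 := step 1%N 2 1%N isT r1 (leN 2 isT) erefl l2.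
have lnk (x : 'I_N.+1) : (0 < x < 7)%N -> twist_linked H tau x (pt 6).
  by rewrite -{3}[x]inord_val; move: (nat_of_ord x) => [|[|[|[|[|[|[|]]]]]]].
apply: (@twisted_perm_mem _ [group of H]) => x.
have [x7|x7] := ltnP x 7; last by rewrite /twist_linked sfix ?eqxx.
have [sx7 _] := s_lt7 x x7.
have s0 : s ord0 = ord0 by have [_ <-] := s_lt7 ord0 isT.
have [x0|x0] := posnP x.
  by rewrite (_ : x = ord0) ?s0 /twist_linked ?eqxx //; apply: val_inj.
have sx0 : (0 < s x)%N.
  rewrite lt0n; apply: contraTneq x0 => sx0; have /perm_inj -> // : s x = s ord0.
  by rewrite s0; apply: val_inj.
apply: (twist_linked_trans (y := pt 6)); first by apply: lnk; rewrite x0.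
by rewrite twist_linked_sym; apply: lnk; rewrite sx0.
Qed.

(** * The whole group is alternating *)

(** With the twist (2 3), [rho 2] links 4 and 5, and conjugation by [rho 3] and [rho 4] extends this
    to all points from 4 on. With the twist changed to (7 8), conjugation by [rho 1] and [rho 0]
    reaches the points below 4. The criterion then applies to every even permutation. *)
Lemma even_par_full s : odd_perm s = false -> s \in par true true true true true.
Proof.
set H := par _ _ _ _ _ => s_even.
have rH k : (k < 5)%N -> rho k \in H.
  by move=> k5; apply: mem_par => //; case: k k5 => [|[|[|[|[|]]]]].
have leN k : (k <= 9)%N -> (k <= N)%N by move=> /leq_trans->.
pose z := tperm (pt 2) (pt 3).
have zC k : (2 < k < 5)%N -> commute (rho k) z.
  by move=> k5; apply: commute_tperm; apply: rho_fix => //; rewrite ?inordK //; try lia;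
    case: k k5 => [|[|[|[|[|]]]]].
have lz x : (4 <= x <= N)%N -> twist_linked H z (pt x) (pt 4).
  elim: x => // x IHx; rewrite ltnS leq_eqVlt => /andP[/orP[/eqP<-|x4] xN].
    by rewrite /twist_linked eqxx.
  have {}IHx : twist_linked H z (pt x) (pt 4) by apply: IHx; rewrite x4 ltnW.
  move: x4; rewrite leq_eqVlt => /orP[/eqP x4|x4].
    apply: pt_link; rewrite tpermC -x4 /z -tperm_commute; try lia.
    by rewrite -rho2E rH.
  have [ox|ox] := boolP (odd x).
    apply: (linked_rho (isT : 3 < 5)%N _ _ _ _ _ _ IHx) => //; try lia; try exact: rH.
    - exact: zC.
    - by rewrite f3E //; [do !case: ifP => //; lia | lia].
  apply: (linked_rho (isT : 4 < 5)%N _ _ _ _ _ _ IHx) => //; try lia; try exact: rH.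
  - exact: zC.
  - by rewrite f4E //; [do !case: ifP => //; lia | lia].
(* [rho 1] does not commute with (2 3), so the twist is moved to (7 8), disjoint from [rho 0] and
   [rho 1]. The link between 7 and 8 puts [y * z] in [H], which converts links for [z] into links
   for [y]. *)
pose y := tperm (pt 7) (pt 8).
have yz : y * z \in H.
  have l7 := lz 7 (leN 7 isT); have l8 := lz 8 (leN 8 isT).
  rewrite twist_linked_sym in l8; have := twist_linked_trans l7 l8.
  by rewrite /twist_linked -val_eqE /= !inordK //; lia.
have yC k : (k < 2)%N -> commute (rho k) y.
  move=> k2; apply: commute_tperm; apply: rho_fix => //; rewrite ?inordK //; try lia;
   by case: k k2 => [|[|]].
have ly4 x : (4 <= x <= N)%N -> twist_linked H y (pt x) (pt 6).
  move=> hx; have : twist_linked H z (pt x) (pt 6).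
    by apply: twist_linked_trans (lz x hx) _; rewrite twist_linked_sym; apply: lz; lia.
  rewrite /twist_linked; case: eqVneq => //= _ xz.
  have -> : tperm (pt x) (pt 6) * y = (tperm (pt x) (pt 6) * z) * (y * z)^-1.
    by rewrite invMg mulgA mulgK tpermV.
  by rewrite groupM // groupV.
have step k i j : (k < 2)%N -> (i <= N)%N -> f k i = j ->
    twist_linked H y (pt i) (pt 6) -> twist_linked H y (pt j) (pt 6).
  move=> k2 iN; have k5 : (k < 5)%N by apply: leq_trans k2 _.
  apply: (linked_rho k5 iN (leN 6 _) (rH k k5) (yC k k2)) => //.
  by case: k k2 {k5} => [|[|]].
have ly3 := step 1%N 4 3 isT (leN 4 isT) erefl (ly4 4 (leN 4 isT)).
have ly2 := step 0 3 2 isT (leN 3 isT) erefl ly3.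
have ly1 := step 1%N 2 1%N isT (leN 2 isT) erefl ly2.
have ly0 := step 0 1%N 0 isT (leN 1%N isT) erefl ly1.
have lnk (x : 'I_N.+1) : twist_linked H y x (pt 6).
  have xN : (x <= N)%N by rewrite -ltnS.
  rewrite -[x]inord_val; move: (nat_of_ord x) xN => [|[|[|[|x']]]] // xN.
  exact: ly4.
have := @twisted_perm_mem _ [group of H] y s; rewrite s_even mulg1; apply=> x.
by apply: twist_linked_trans (lnk x) _; rewrite twist_linked_sym; apply: lnk.
Qed.

(** * Intersections of maximal subgroups, and the conclusion *)

Lemma par_maximal b0 b1 b2 b3 b4 g : g \in par true true true true true ->
    (~~ b0 -> g \in par false true true true true) ->
    (~~ b1 -> g \in par true false true true true) ->
    (~~ b2 -> g \in par true true false true true) ->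
    (~~ b3 -> g \in par true true true false true) ->
    (~~ b4 -> g \in par true true true true false) ->
  g \in par b0 b1 b2 b3 b4.
Proof.
move=> gG g0 g1 g2 g3 g4.
have fix0 : ~~ b0 -> g ord0 = ord0.
  by move=> /g0 gP; apply: (par_fix gP).
have leN k : (k <= 9)%N -> (k <= N)%N by move=> /leq_trans->.
have ptE k : (k <= 9)%N -> pt k = k :> nat by move=> k9; rewrite inordK // ltnS leN.
have fixN : ~~ b4 -> g (pt N) = pt N.
  move=> /g4 gP; apply: (par_fix gP) => // _; rewrite inordK //.
  - exact/f0_fix/leN.
  - exact/f1_fix/leN.
  - exact/f2_fix/leN.
  - by rewrite f3E ?eqxx // leqnn leN.
have blk : ~~ b1 -> forall x : 'I_N.+1, block (g x) = block x.
  by move=> /g1 gP x; apply: par0234_block gP.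
have ge4 : ~~ b1 -> (4 <= g (pt 4))%N.
  by move=> /blk/(_ (pt 4)); rewrite ptE //; case: (nat_of_ord _) => [|[|[|[|]]]].
have lt6 : ~~ b3 -> (g (pt 5) < 6)%N.
  move=> /g3 gP; apply: (par_stable (P := fun z => (z < 6)%N) gP); last by rewrite ptE.
  by move=> z z6; split=> // _; try (by rewrite f4_fix); move: z z6 => [|[|[|[|[|[|]]]]]].
(* In each of the 32 cases missing labels are put back one at a time, each licensed by one of the
   facts above, until a maximal group or the whole group is reached. *)
case: b0 g0 fix0; case: b1 g1 blk ge4; case: b2 g2; case: b3 g3 lt6; case: b4 g4 fixN;
  move=> g4 fixN g3 lt6 g2 g1 blk ge4 g0 fix0;
  repeat first
    [ exact: gG | exact: g0 | exact: g1 | exact: g2 | exact: g3 | exact: g4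
    | apply: drop_gen4; last exact: fixN
    | apply: drop_gen0; last exact: fix0
    | apply: drop_gen0_of01; last exact: fix0
    | apply: drop_gen1_of01; last exact: ge4
    | apply: drop_gen4_of34; last exact: fixN
    | apply: drop_gen3_of34; last exact: lt6
    | apply: drop_gen0_of0124; last exact: fix0
    | apply: drop_gen1_of0124; last exact: blk
    | apply: drop_gen0_of0123; last exact: fix0
    | apply: drop_gen1_of0123; last exact: blk ].
Qed.

Lemma intersection_property_rho : intersection_property 5 rho.
Proof.
apply: intersection_property_maximal => J g gG gJ.
have maxE k : (k < 5)%N -> ~~ ((inord k : 'I_5) \in J) ->
   g \in par (0 != k) (1%N != k) (2 != k) (3 != k) (4 != k).
  move=> k5 /gJ; rewrite par_gens !inE -!val_eqE /= !inordK //.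
rewrite par_gens; apply: par_maximal => [|/maxE|/maxE|/maxE|/maxE|/maxE]; try by apply.
by move: gG; rewrite /sggi_group par_gens !inE.
Qed.

Lemma sggi_group_rho : sggi_group 5 rho = 'Alt_('I_N.+1).
Proof.
rewrite /sggi_group par_gens !inE; apply/setP=> s; rewrite Alt_even.
apply/idP/idP => [sP|/negbTE]; last exact: even_par_full.
by rewrite (par_even sP).
Qed.

End Main.

Close Scope group_scope.

Theorem theorem4p3 (n : nat) (hn : 10 <= n) (hmod : n %% 4 = 2) :
  let rho := lgraph_perm n (thm43_edges n) in
  (sggi_group 5 rho \isog Alt 'I_n)%g /\
  is_string_C_group 5 rho /\
  schlafli_type 5 rho = [:: 5; 5; 6; n - 5].
Proof.
case: n hn hmod => // N N_ge9 hmod rho.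
have N_mod4 : N %% 4 = 1%N by lia.
split; first by rewrite /rho sggi_group_rho //; apply: isog_refl.
split; first by split; [apply: sggi_rho | apply: intersection_property_rho].
by rewrite /schlafli_type /= /rho order01 // order12 // order23 // order34 //.
Qed.
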